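(* $\mathring{\mathcal{P}}_n$ is a two-sided ideal of the peak algebra $\mathcal{P}_n$. Moreover, for $n\geq 2$, $\mathcal{P}_n/\mathring{\mathcal{P}}_n\cong\mathcal{P}_{n-2}$.
   Context: $\mathfrak{S}_n$ is the symmetric group, $u=u_1\dots u_n$, with group algebra $\mathbb{Q}\mathfrak{S}_n$ (product = composition). $\mathrm{Peak}(u)=\{i\in[n-1]: u_{i-1}<u_i>u_{i+1}\}$ with $u_0=0$; the interior peak set is $\mathring{\mathrm{Peak}}(u)=\{i\in\{2,\dots,n-1\}: u_{i-1}<u_i>u_{i+1}\}$. $\mathcal{F}_n$ is the set of subsets of $[n-1]$ with no two consecutive integers, and $\mathring{\mathcal{F}}_n=\{F\in\mathcal{F}_n: 1\notin F\}$. $P_F=\sum_{\mathrm{Peak}(u)=F}u$ ($F\in\mathcal{F}_n$), $\mathring{P}_F=\sum_{\mathring{\mathrm{Peak}}(u)=F}u$ ($F\in\mathring{\mathcal{F}}_n$). The peak algebra is $\mathcal{P}_n=\mathrm{span}\{P_F\}$ (a subalgebra of $\mathbb{Q}\mathfrak{S}_n$), the peak ideal is $\mathring{\mathcal{P}}_n=\mathrm{span}\{\mathring{P}_F\}$. By convention $\mathcal{P}_0=\mathcal{P}_1=\mathbb{Q}$. *)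

(* Defs.v *)
From HB Require Import structures.
From mathcomp Require Import all_boot all_order all_algebra all_fingroup.
Set Implicit Arguments. Unset Strict Implicit. Unset Printing Implicit Defensive.
Import Order.TTheory GRing.Theory Num.Theory.
Local Open Scope ring_scope.

(* Elements of the group algebra Q S_n: x = \sum_u x(u) u. *)
Notation GA n := {ffun 'S_n -> rat^o}.

(* One-line notation, 1-based: u_i = (u (i-1)) + 1 for 1 <= i <= n, u_0 = 0. *)
Definition word n (u : 'S_n) (i : nat) : nat :=
  if ((0 < i) && (i <= n))%N then
    (if @insub _ (fun k => k < n)%N 'I_n (i.-1) is Some j then (u j : nat).+1 else 0)%N
  else 0%N.

(* Position i (1-based) is encoded by the ordinal i : 'I_n; position 0 is never
   a peak, so sets F : {set 'I_n} with 0 \notin F are subsets of [n-1]. *)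
Definition is_peak n (u : 'S_n) (i : nat) : bool :=
  [&& (0 < i)%N, (word u i.-1 < word u i)%N & (word u i.+1 < word u i)%N].

Definition Peak n (u : 'S_n) : {set 'I_n} := [set i : 'I_n | is_peak u i].
Definition iPeak n (u : 'S_n) : {set 'I_n} :=
  [set i : 'I_n | (1 < i)%N && is_peak u i].

Definition inFn n (F : {set 'I_n}) : bool :=
  [forall i : 'I_n, (i \in F) ==> ((0 < i)%N && ~~ [exists j : 'I_n, (j \in F) && (val j == i.+1)])].
Definition iinFn n (F : {set 'I_n}) : bool :=
  inFn F && [forall i : 'I_n, (i \in F) ==> (1 < i)%N].

Definition PF n (F : {set 'I_n}) : GA n := [ffun u => ((Peak u == F) : nat)%:R].
Definition iPF n (F : {set 'I_n}) : GA n := [ffun u => ((iPeak u == F) : nat)%:R].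

(* product = composition: u . v = u \o v, which is (v * u)%g in mathcomp *)
Definition gmul n (x y : GA n) : GA n :=
  [ffun w => \sum_(u : 'S_n) \sum_(v : 'S_n) (((v * u)%g == w) : nat)%:R * x u * y v].
Definition gone n : GA n := [ffun u => ((u == 1%g) : nat)%:R].

Definition in_peak_alg n (x : GA n) : Prop :=
  exists c : {set 'I_n} -> rat, x = \sum_(F | inFn F) c F *: PF F.
Definition in_peak_ideal n (x : GA n) : Prop :=
  exists c : {set 'I_n} -> rat, x = \sum_(F | iinFn F) c F *: iPF F.

(* Main.v *)
(**
Write s_i for the transposition of the values i and i+1. A function f on S_n
is constant on descent classes iff f(s_i w) = f(w) whenever i and i+1 are not
adjacent in w, that is, iff (1 - s_i) f is a sum of terms z_j (1 - s_j) with
z_j supported on the permutations with i, i+1 at positions j, j+1; this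
condition is visibly stable under products. Constancy on interior peak classes
amounts to the additional equation (1 - s_1) f = 0. If x lies in the peak
algebra, then (1 - s_1) x = x' (1 - s_1), where x' is supported on the copy of
S_(n-2) fixing 1 and 2, with x'(w) = x(12w) - x(21w). Hence
(1 - s_1) x y = x' (1 - s_1) y, which is 0 for y in the peak ideal and
x' y' (1 - s_1) for y in the peak algebra, so x |-> x' is multiplicative with
kernel the peak ideal; it lands in, and is onto, the peak algebra of S_(n-2)
because Peak(21w) is Peak(12w) together with 1, and Peak(12w) is Peak(w)
shifted by 2.
*)
Require Import Defs.
From mathcomp Require Import all_boot all_order all_algebra all_fingroup.
From mathcomp Require Import zify ring.
Import GRing.Theory.
Local Open Scope ring_scope.

Set Implicit Arguments.
Unset Strict Implicit.
Unset Printing Implicit Defensive.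

Local Open Scope nat_scope.

(** * Exchanging two consecutive values: effect on descents and peaks *)

Definition swap_succ (c x : nat) : nat :=
  if x == c then c.+1 else if x == c.+1 then c else x.

Definition adjacent (p q : nat) : bool := (p.+1 == q) || (q.+1 == p).

Definition desc n (u : 'S_n) (i : nat) : bool := word u i.+1 < word u i.
Definition Des n (u : 'S_n) : {set 'I_n} := [set i : 'I_n | desc u i].

Lemma swap_succ_ltn c x y : ~~ ((x == c) && (y == c.+1)) ->
  ~~ ((x == c.+1) && (y == c)) -> (swap_succ c x < swap_succ c y) = (x < y).
Proof.
by rewrite /swap_succ; do 2!case: eqP; do 2!case: eqP; lia.
Qed.

Section Words.
Variable n : nat.
Implicit Types (u v : 'S_n) (a b p q : 'I_n).

Lemma word0 u : word u 0 = 0. Proof. by []. Qed.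

Lemma word_ord u p : word u p.+1 = (u p).+1.
Proof. by rewrite /word /= ltn_ord valK. Qed.

Lemma word_gt0 u i : 0 < i <= n -> 0 < word u i.
Proof. by case: i => // i /= ilt; rewrite (word_ord u (Ordinal ilt)). Qed.

Lemma word_inj u i j : 0 < i <= n -> 0 < j <= n -> word u i = word u j -> i = j.
Proof.
case: i j => // i [|j] //= ilt jlt.
rewrite (word_ord u (Ordinal ilt)) (word_ord u (Ordinal jlt)).
by move=> [] /val_inj /perm_inj [->].
Qed.

Lemma word_eq_val u i a : word u i = a.+1 -> i = ((u^-1)%g a).+1.
Proof.
rewrite /word; case: ifP => // /andP[]; case: i => // i _ /= ilt.
rewrite (insubT (fun k => k < n) ilt) /= => -[] /val_inj <-.
by rewrite permK.
Qed.

Lemma word_succ_neq u i : i < n -> word u i != word u i.+1.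
Proof.
case: i => [|i] ilt; first by have := @word_gt0 u 1 ilt; rewrite word0; case: word.
by apply/eqP => /word_inj; lia.
Qed.

(** [u * t] applies [u] first, so the transposition acts on values; [a.+1] appears because words are
    1-based. *)
Lemma word_tperm u a b i : b = a.+1 :> nat ->
  word (u * tperm a b)%g i = swap_succ a.+1 (word u i).
Proof.
move=> ab; case: i => [|i]; first by [].
case: (ltnP i n) => [ilt|ige]; last first.
  by rewrite /word /= ltnNge ige.
rewrite !(word_ord _ (Ordinal ilt)) permM /swap_succ !eqSS.
case: tpermP => [->|->|]; rewrite ?eqxx ?ab ?eqxx //.
  by case: eqP => //; lia.
move=> /eqP; rewrite -val_eqE /= => /negbTE->.
by move=> /eqP; rewrite -val_eqE /= ab => /negbTE->.
Qed.

(** The exchange reverses only the comparison between the two exchanged values, and these are not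
    neighbours in the word. *)
Lemma ltn_word_tperm u a b i : b = a.+1 :> nat ->
  ~~ adjacent ((u^-1)%g a) ((u^-1)%g b) -> i < n ->
  ((word (u * tperm a b)%g i < word (u * tperm a b)%g i.+1) =
     (word u i < word u i.+1)) *
  (desc (u * tperm a b)%g i = desc u i).
Proof.
move=> ab nadj ilt; rewrite /desc !word_tperm //.
have E c : word u c = a.+1 -> c = ((u^-1)%g a).+1 by apply: word_eq_val.
have F c : word u c = a.+2 -> c = ((u^-1)%g b).+1.
  by rewrite -ab; apply: word_eq_val.
rewrite /adjacent in nadj.
split; apply: swap_succ_ltn; apply/negP => /andP[/eqP e1 /eqP e2];
  (move: (E _ e1) (F _ e2) || move: (E _ e2) (F _ e1)); lia.
Qed.

Lemma is_peakE u i : i < n -> is_peak u i = [&& 0 < i, ~~ desc u i.-1 & desc u i].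
Proof.
move=> ilt; rewrite /is_peak /desc; case: i ilt => //= i ilt.
have := @word_succ_neq u i (ltnW ilt); lia.
Qed.

Lemma Peak_tperm u a b : b = a.+1 :> nat ->
  ~~ adjacent ((u^-1)%g a) ((u^-1)%g b) -> Peak (u * tperm a b)%g = Peak u.
Proof.
move=> ab nadj; apply/setP => i; rewrite !inE !is_peakE ?ltn_ord //.
by rewrite !(ltn_word_tperm ab nadj) ?ltn_ord //; have := ltn_ord i; lia.
Qed.

Lemma Des_tperm u a b : b = a.+1 :> nat ->
  ~~ adjacent ((u^-1)%g a) ((u^-1)%g b) -> Des (u * tperm a b)%g = Des u.
Proof.
by move=> ab nadj; apply/setP => i; rewrite !inE (ltn_word_tperm ab nadj).
Qed.

Lemma iPeak_Peak u : iPeak u = [set i in Peak u | 1 < i].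
Proof. by apply/setP => i; rewrite !inE andbC. Qed.

Lemma iPeak_Des u v : Des u = Des v -> iPeak u = iPeak v.
Proof.
move=> /setP e; apply/setP => i; rewrite !inE !is_peakE ?ltn_ord //.
have ilt : i.-1 < n by have := ltn_ord i; lia.
by have := e i; have := e (Ordinal ilt); rewrite !inE /= => -> ->.
Qed.

(** A peak beyond position 1 is the largest of three distinct positive entries, hence at least 3, so
    exchanging 1 and 2 does not affect it. At position 1 the left neighbour is 0, and only an
    initial pair made of 1 and 2 matters. *)
Lemma is_peak_tperm01 u a b i : a = 0 :> nat -> b = 1 :> nat -> i < n ->
  (1 < i) || ~~ [&& word u 1 <= 2 & word u 2 <= 2] ->
  is_peak (u * tperm a b)%g i = is_peak u i.
Proof.
move=> a0 b1 ilt H; rewrite /is_peak !word_tperm; try lia.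
case: i ilt H => //= i ilt H; rewrite a0.
have y0 : 0 < word u i.+1 by apply: word_gt0; lia.
have z0 : 0 < word u i.+2 by apply: word_gt0; lia.
have yz : word u i.+1 != word u i.+2 by apply: word_succ_neq.
have xy : word u i != word u i.+1 by apply: word_succ_neq; lia.
have xz : word u i != word u i.+2.
  by case: i ilt {H xy yz y0} z0 => [|i] ilt z0; [rewrite word0; lia | apply/eqP => /word_inj; lia].
case: i ilt H y0 z0 yz xy xz => [|i] ilt.
  by rewrite word0 => H *; rewrite !swap_succ_ltn; lia.
have x0 : 0 < word u i.+1 by apply: word_gt0; lia.
move=> _; move: x0; rewrite /swap_succ.
by move: (word u i.+1) (word u i.+2) (word u i.+3) => x y z; do ?case: eqP; lia.
Qed.

Lemma iPeak_tperm01 u a b : a = 0 :> nat -> b = 1 :> nat ->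
  iPeak (u * tperm a b)%g = iPeak u.
Proof.
move=> a0 b1; apply/setP => i; rewrite !inE; case: ltnP => //= i1.
by apply: is_peak_tperm01; rewrite ?i1.
Qed.

Lemma Peak_tperm01 u a b : a = 0 :> nat -> b = 1 :> nat ->
  ~~ [&& word u 1 <= 2 & word u 2 <= 2] -> Peak (u * tperm a b)%g = Peak u.
Proof.
move=> a0 b1 H; apply/setP => i; rewrite !inE.
by apply: is_peak_tperm01; rewrite ?H ?orbT.
Qed.

Lemma Peak_inFn u : inFn (Peak u).
Proof.
apply/forallP => i; apply/implyP; rewrite inE is_peakE // => /and3P[-> _ di] /=.
apply/existsP => -[j /andP[]]; rewrite inE is_peakE // => /and3P[_ ndj _] /eqP ji.
by move: ndj; rewrite ji di.
Qed.

Lemma iPeak_iinFn u : iinFn (iPeak u).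
Proof.
apply/andP; split; last by apply/forallP => i; apply/implyP; rewrite inE => /andP[].
apply/forallP => i; apply/implyP; rewrite inE => /andP[i1 pi].
have /forallP/(_ i)/implyP := Peak_inFn u; rewrite inE => /(_ pi) /andP[-> ne] /=.
apply: contra ne => /existsP[j /andP[]]; rewrite !inE => /andP[_ pj] ji.
by apply/existsP; exists j; rewrite inE pj.
Qed.

End Words.

(** * Connectivity of descent classes and interior peak classes under these exchanges *)

Definition nonadj_invariant n (T : Type) (f : 'S_n -> T) : Prop :=
  forall (u : 'S_n) (a b : 'I_n), b = a.+1 :> nat ->
    ~~ adjacent ((u^-1)%g a) ((u^-1)%g b) -> f (u * tperm a b)%g = f u.

Definition swap01_invariant n (T : Type) (f : 'S_n -> T) : Prop :=
  forall (u : 'S_n) (a b : 'I_n), a = 0 :> nat -> b = 1 :> nat ->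
    f (u * tperm a b)%g = f u.

(** Strict growth gives [a <= w a]; both sides have the same sum over [a], so equality holds
    throughout. *)
Lemma perm_succ_mono_eq1 n (w : 'S_n) :
  (forall a b : 'I_n, b = a.+1 :> nat -> w a < w b) -> w = 1%g.
Proof.
move=> wmono.
have w_ge (a : 'I_n) : a <= w a.
  case: a => m; elim: m => [|m IHm] mlt //=.
  have mlt' : m < n by lia.
  exact: leq_ltn_trans (IHm mlt') (wmono (Ordinal mlt') (Ordinal mlt) erefl).
have [_] := leqif_sum (fun a (_ : xpredT a) => leqif_eq (w_ge a)).
have <- : \sum_(a < n) a = \sum_(a < n) w a by rewrite (reindex_inj (@perm_inj _ w)).
rewrite eqxx => /esym/forallP wE.
by apply/permP => a; rewrite perm1; apply/val_inj/esym/eqP/wE.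
Qed.

(** Elements of [Des] are 1-based positions while arguments of [u] are 0-based, so the descent [q]
    compares the entries indexed by [p] and [q]. *)
Lemma in_Des_succ n (u : 'S_n) (p q : 'I_n) :
  p.+1 = q -> (q \in Des u) = (u q < u p).
Proof. by move=> pq; rewrite inE /desc -{2}pq !word_ord. Qed.

Section Connectivity.
Variables (n : nat) (T : eqType) (f : 'S_n -> T).
Hypothesis f_nonadj : nonadj_invariant f.

(* Among the permutations in the descent class of [v] with the same [f]-value,
   the one closest to [u] (largest scalar product) must be [u]: otherwise some
   values [a], [a+1] of it are inverted in [u], and swapping them gets closer. *)
Lemma nonadj_invariant_Des u v : Des u = Des v -> f u = f v.
Proof.
move=> Duv.
pose P (w : 'S_n) := (Des w == Des u) && (f w == f v).
have Pv : P v by rewrite /P Duv !eqxx.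
case: (arg_maxnP (fun w : 'S_n => \sum_(p < n) u p * w p) Pv) => w /andP[/eqP Dw /eqP fw] wmax.
suff e : (w^-1 * u)%g = 1%g by rewrite -fw -[u](mulKVg w) e mulg1.
apply: perm_succ_mono_eq1 => a b ab; rewrite !permM.
set p := (w^-1)%g a; set q := (w^-1)%g b.
have wp : w p = a by rewrite /p permKV.
have wq : w q = b by rewrite /q permKV.
have pq : p != q by apply: contraTneq isT => pq; move: wq ab; rewrite -pq wp => ->; lia.
have upq : u p != u q by rewrite (inj_eq perm_inj).
case: ltngtP upq => // [uqp _ | /val_inj ->]; last by rewrite eqxx.
(* Neighbouring positions would be compared oppositely by [w] and [u], against [Dw]. *)
have nadj : ~~ adjacent p q.
  rewrite /adjacent; apply/negP => /orP[] /eqP e.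
    have := in_Des_succ w e; rewrite Dw (in_Des_succ _ e) wp wq; lia.
  by have := in_Des_succ w e; rewrite Dw (in_Des_succ _ e) wp wq; lia.
have /wmax : P (w * tperm a b)%g by rewrite /P Des_tperm // Dw f_nonadj // fw !eqxx.
rewrite (bigD1 p) // (bigD1 q) 1?eq_sym //= [X in _ >= X -> _](bigD1 p) // (bigD1 q) 1?eq_sym //=.
rewrite !permM wp wq tpermL tpermR.
rewrite (eq_bigr (fun i => u i * w i)) => [|i /andP[ip iq]]; last first.
  by rewrite permM tpermD // -?wp -?wq (inj_eq perm_inj) eq_sym.
by rewrite /geq /= ab; nia.
Qed.

(** Minimise [w p + w q] over the class. If [w q] were positive, the value just below it would sit
    next to [q], whose neighbours all carry larger values; so [w q] is 0. Then the value just below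
    [w p] must be that 0. *)
Lemma valley_normal_form u (p q : 'I_n) :
  p.+1 = q -> q \in Des u -> (p == 0 :> nat) || (p \in Des u) ->
  (forall r : 'I_n, q.+1 = r -> r \notin Des u) ->
  exists w, [/\ Des w = Des u, f w = f u, w q = 0 :> nat & w p = 1 :> nat].
Proof.
move=> pq qD pD rD.
pose P (w : 'S_n) := (Des w == Des u) && (f w == f u).
have Pu : P u by rewrite /P !eqxx.
case: (arg_minnP (fun w : 'S_n => w p + w q) Pu) => w /andP[/eqP Dw /eqP fw] wmin.
rewrite -Dw (in_Des_succ _ pq) in qD.
have lower (a b : 'I_n) : b = a.+1 :> nat ->
    (w q == b) || (w p == b) && (w q < a) -> adjacent ((w^-1)%g a) ((w^-1)%g b).
  move=> ab wb; apply/negPn/negP => nadj.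
  have /wmin : P (w * tperm a b)%g by rewrite /P Des_tperm // Dw f_nonadj // fw !eqxx.
  rewrite !permM; case/orP: wb => [/eqP wqb | /andP[/eqP wpb wqa]].
    by rewrite wqb in qD; rewrite wqb tpermR tpermD -?val_eqE /=; lia.
  by rewrite wpb tpermR tpermD -?val_eqE /=; lia.
have wq0 : w q = 0 :> nat.
  case: (posnP (w q)) => // wq0; exfalso.
  have alt : (w q).-1 < n by have := ltn_ord (w q); lia.
  have ab : w q = (Ordinal alt).+1 :> nat by rewrite /=; lia.
  have := lower _ _ ab; rewrite eqxx permK => /(_ isT).
  case/orP => /eqP e.
    have sp : (w^-1)%g (Ordinal alt) = p by apply: val_inj => /=; lia.
    by move: qD ab; rewrite -sp permKV /=; lia.
  by have := rD _ e; rewrite -Dw (in_Des_succ _ e) permKV /=; lia.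
exists w; split=> //; apply/eqP; case: ltngtP => //; first by lia.
move=> wp1; exfalso.
have alt : (w p).-1 < n by have := ltn_ord (w p); lia.
have ab : w p = (Ordinal alt).+1 :> nat by rewrite /=; lia.
have := lower _ _ ab; rewrite eqxx permK wq0 orbC /= -ltnS prednK ?wp1 //; last by lia.
move=> /(_ isT) /orP[] /eqP e.
  move: pD; rewrite -Dw (in_Des_succ _ e) permKV /=; lia.
have sq : (w^-1)%g (Ordinal alt) = q by apply: val_inj => /=; lia.
by move: wq0; rewrite -sq permKV /=; lia.
Qed.

Hypothesis f_01 : swap01_invariant f.

(* The largest descent [q] that is not an interior peak is followed by a valley;
   once the values 2 1 sit there, exchanging them removes the descent [q]. *)
Lemma Des_eq_iPeak_normal_form u :
  exists v, [/\ iPeak v = iPeak u, f v = f u & Des v = iPeak v].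
Proof.
pose P (w : 'S_n) := (iPeak w == iPeak u) && (f w == f u).
have Pu : P u by rewrite /P !eqxx.
(* With the fewest descents chosen, removing one more is a contradiction. *)
case: (arg_minnP (fun w : 'S_n => #|Des w|) Pu) => v /andP[/eqP pv /eqP fv] vmin.
exists v; split=> //; apply/eqP; rewrite eqEsubset andbC; apply/andP; split.
  by apply/subsetP => i; rewrite !inE is_peakE // => /and4P[].
apply/negPn/negP => /subsetPn[i iD iP].
pose Q (i : 'I_n) := (i \in Des v) && (i \notin iPeak v).
have Qi : Q i by rewrite /Q iD.
case: (arg_maxnP val Qi) => q /andP[qD qP] qmax.
have q0 : 0 < q by rewrite lt0n; apply: contraTneq qD => q0; rewrite inE /desc q0 word0.
have plt : q.-1 < n by have := ltn_ord q; lia.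
pose p := Ordinal plt.
have pq : p.+1 = q by rewrite /=; lia.
have pD : (p == 0 :> nat) || (p \in Des v).
  by move: qP qD; rewrite !inE is_peakE // => /[swap] -> /=; lia.
(* A descent right after the descent [q] is not a peak, against the maximality of [q]. *)
have rD (r : 'I_n) : q.+1 = r -> r \notin Des v.
  move=> qr; apply/negP => rD; have /qmax : Q r.
    by rewrite /Q rD inE is_peakE // -qr /=; move: qD; rewrite inE => ->; rewrite !andbF.
  by rewrite /geq /= -qr ltnn.
have [w [Dw fw wq wp]] := valley_normal_form pq qD pD rD.
have /vmin : P (w * tperm (w q) (w p))%g.
  by rewrite /P iPeak_tperm01 // f_01 // fw (iPeak_Des Dw) pv fv !eqxx.
apply/negP; rewrite -ltnNge -Dw; apply: proper_card; apply/properP; split; last first.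
  exists q; first by rewrite Dw.
  by rewrite (in_Des_succ _ pq) !permM tpermL tpermR wq wp.
apply/subsetP => j; rewrite !inE.
case: (eqVneq j q) => [-> | jq].
  by move: qD; rewrite -Dw inE.
rewrite /desc !word_tperm ?wq ?wp // swap_succ_ltn //; apply/negP => /andP[/eqP e1 /eqP e2].
  have := @word_eq_val n w j.+1 (w q); rewrite wq => /(_ e1).
  by rewrite permK => -[] /val_inj/eqP; apply/negP.
have := @word_eq_val n w j.+1 (w p); rewrite wp => /(_ e1); rewrite permK.
have := @word_eq_val n w j (w q); rewrite wq => /(_ e2); rewrite permK.
by lia.
Qed.

Lemma invariant_iPeak u v : iPeak u = iPeak v -> f u = f v.
Proof.
move=> uv; have [u' [pu <- Du]] := Des_eq_iPeak_normal_form u.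
have [v' [pv <- Dv]] := Des_eq_iPeak_normal_form v.
by apply: nonadj_invariant_Des; rewrite Du Dv pu pv.
Qed.

End Connectivity.

Local Open Scope ring_scope.

(** * Peak algebra and peak ideal as functions constant on classes *)

Lemma span_fiberP n (P : 'S_n -> {set 'I_n}) (good : pred {set 'I_n}) (x : GA n) :
  (forall u, good (P u)) ->
  (exists c : {set 'I_n} -> rat,
     x = \sum_(F | good F) c F *: [ffun u => ((P u == F) : nat)%:R : rat^o]) <->
  (forall u v, P u = P v -> x u = x v).
Proof.
move=> goodP.
have E (c : {set 'I_n} -> rat) u :
    (\sum_(F | good F) c F *: [ffun u => ((P u == F) : nat)%:R : rat^o]) u = c (P u).
  rewrite sum_ffunE (bigD1 (P u)) //= !ffunE eqxx big1 ?addr0 ?[_ *: _]mulr1 //.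
  by move=> F /andP[_ /negbTE FP]; rewrite !ffunE eq_sym FP [_ *: _]mulr0.
split=> [[c ->] u v uv | xP]; first by rewrite !E uv.
(* The coefficient is the common value of [x] on the fibre; 0 serves for empty fibres. *)
exists (fun F => if [pick u | P u == F] is Some u then x u else 0).
apply/ffunP => u; rewrite E; case: pickP => [v /eqP/xP //|/(_ u)].
by rewrite eqxx.
Qed.

Section GroupAlgebra.
Variable n : nat.
Implicit Types (x y : GA n) (u v w : 'S_n) (a b : 'I_n).

Lemma peak_algP x : in_peak_alg x <-> forall u v, Peak u = Peak v -> x u = x v.
Proof. exact: span_fiberP (@Peak_inFn n). Qed.

Lemma peak_idealP x : in_peak_ideal x <-> forall u v, iPeak u = iPeak v -> x u = x v.
Proof. exact: span_fiberP (@iPeak_iinFn n). Qed.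

Lemma peak_ideal_sub_alg x : in_peak_ideal x -> in_peak_alg x.
Proof.
move=> /peak_idealP xP; apply/peak_algP => u v uv; apply: xP.
by rewrite !iPeak_Peak uv.
Qed.

Lemma peak_alg_nonadj x : in_peak_alg x -> nonadj_invariant x.
Proof. by move=> /peak_algP xP u a b ab nadj; apply/xP/Peak_tperm. Qed.

(** Membership in the ideal becomes a set of equations that can be followed through a product. *)
Lemma peak_ideal_invariantP x :
  in_peak_ideal x <-> nonadj_invariant x /\ swap01_invariant x.
Proof.
split=> [xI | [xn x01]]; last by apply/peak_idealP => u v; apply: invariant_iPeak.
split; first exact/peak_alg_nonadj/peak_ideal_sub_alg.
by move/peak_idealP: xI => xI u a b a0 b1; apply/xI/iPeak_tperm01.
Qed.

(** * Products and the invariance equations *)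

Lemma gmulE x y w : gmul x y w = \sum_u x u * y (w * u^-1)%g.
Proof.
rewrite ffunE; apply: eq_bigr => u _; rewrite (bigD1 (w * u^-1)%g) //= mulgKV eqxx mul1r.
rewrite big1 ?addr0 // => v; rewrite -(inj_eq (mulIg u)) mulgKV => /negbTE->.
by rewrite !mul0r.
Qed.

Lemma tperm_mulg_inv w u a b :
  (w * tperm a b * u^-1 = w * u^-1 * tperm ((u^-1)%g a) ((u^-1)%g b))%g.
Proof. by rewrite -tpermJ conjgE invgK !mulgA mulgKV. Qed.

(* The factors are the coefficients of [(1 - s) x] at [u] and, after moving [s]
   across [u], of [(1 - s') y] with [s'] the conjugate of [s = tperm a b]. *)
Lemma gmul_tperm_diff x y w a b :
  (gmul x y w - gmul x y (w * tperm a b)%g) *+ 2 =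
  \sum_u (x u - x (u * tperm a b)%g) *
    (y (w * u^-1)%g - y (w * tperm a b * u^-1)%g).
Proof.
(* Reindexing by the transposition gives a second form of each product; adding both forms produces
   the factor 2. *)
have shift w' : gmul x y w' = \sum_u x (u * tperm a b)%g * y (w' * tperm a b * u^-1)%g.
  rewrite gmulE (reindex_inj (mulIg (tperm a b))) /=; apply: eq_bigr => u _.
  by rewrite invMg tpermV mulgA.
rewrite mulr2n {1}gmulE {1}gmulE shift shift -mulgA tperm2 mulg1.
rewrite -!sumrB -big_split /=; apply: eq_bigr => u _.
by ring.
Qed.

Lemma gmul_tperm_eq x y w a b :
  (forall u, x (u * tperm a b)%g = x u \/
     y (w * u^-1 * tperm ((u^-1)%g a) ((u^-1)%g b))%g = y (w * u^-1)%g) ->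
  gmul x y (w * tperm a b)%g = gmul x y w.
Proof.
move=> H; apply/esym/eqP; rewrite -subr_eq0.
suff : (gmul x y w - gmul x y (w * tperm a b)%g) *+ 2 == 0 by rewrite Num.Theory.mulrn_eq0.
rewrite gmul_tperm_diff big1 // => u _; rewrite tperm_mulg_inv.
by case: (H u) => ->; rewrite subrr ?mul0r ?mulr0.
Qed.

(** If [a], [b] are not adjacent in [u], the factor from [x] vanishes. Otherwise the conjugate
    exchanges consecutive values, whose positions in [w * u^-1] are those of [a], [b] in [w], and
    the factor from [y] vanishes. *)
Lemma gmul_nonadj x y :
  nonadj_invariant x -> nonadj_invariant y -> nonadj_invariant (gmul x y).
Proof.
move=> xn yn w a b ab nadj; apply: gmul_tperm_eq => u.
case: (boolP (adjacent ((u^-1)%g a) ((u^-1)%g b))) => [adj | nadju]; last by left; apply: xn.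
have posE c : ((w * u^-1)^-1)%g ((u^-1)%g c) = (w^-1)%g c.
  by rewrite invMg invgK permM permKV.
right; case/orP: adj => /eqP e; first by apply: yn; rewrite ?posE.
by rewrite tpermC; apply: yn; rewrite ?posE // /adjacent orbC.
Qed.

Lemma first_values u a b : a = 0%N :> nat -> b = 1%N :> nat ->
  (word u 1 <= 2)%N && (word u 2 <= 2)%N ->
  (u a = a /\ u b = b) \/ (u a = b /\ u b = a).
Proof.
move=> a0 b1; have := word_ord u a; have := word_ord u b; rewrite a0 b1 => -> -> H.
have : u a != u b by rewrite (inj_eq perm_inj) -val_eqE /= a0 b1.
rewrite -val_eqE /= => ne.
case: (eqVneq (u a) a) => [e | /negbTE e].
  by left; split=> //; apply: val_inj => /=; move: H ne; rewrite e; lia.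
move: e; rewrite -val_eqE /= => e.
by right; split; apply: val_inj => /=; lia.
Qed.

Lemma peak_alg_tperm01 x u a b : in_peak_alg x -> a = 0%N :> nat -> b = 1%N :> nat ->
  x (u * tperm a b)%g = x u \/ (u a = a /\ u b = b) \/ (u a = b /\ u b = a).
Proof.
move=> /peak_algP xP a0 b1.
case: (boolP ((word u 1 <= 2)%N && (word u 2 <= 2)%N)) => H.
  by right; apply: first_values.
by left; apply/xP/Peak_tperm01.
Qed.

(** Where [x] changes under the exchange of the two least values, [u] preserves that pair, so the
    transposition is its own conjugate by [u] and [y] is invariant under it. In [gmul y x] the first
    factor always vanishes. *)
Lemma peak_ideal_gmul x y : in_peak_alg x -> in_peak_ideal y ->
  in_peak_ideal (gmul x y) /\ in_peak_ideal (gmul y x).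
Proof.
move=> xA /peak_ideal_invariantP[yn y01]; have xn := peak_alg_nonadj xA.
split; apply/peak_ideal_invariantP; split; try exact: gmul_nonadj.
  move=> w a b a0 b1; apply: gmul_tperm_eq => u.
  have [?|H] := peak_alg_tperm01 u xA a0 b1; [by left | right].
  have inv c d : u c = d -> (u^-1)%g d = c by move=> <-; rewrite permK.
  by case: H => -[/inv-> /inv->]; rewrite 1?[tperm b a]tpermC; apply: y01.
by move=> w a b a0 b1; apply: gmul_tperm_eq => u; left; apply: y01.
Qed.

End GroupAlgebra.

(** * The quotient map onto the peak algebra of degree two less *)

Section Quotient.
Variable k : nat.
Implicit Types (x y : GA k.+2) (u v w : 'S_k) (z : GA k).

Let o0 : 'I_k.+2 := Ordinal (isT : (0 < k.+2)%N).
Let o1 : 'I_k.+2 := Ordinal (isT : (1 < k.+2)%N).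
Let s := tperm o0 o1.

Definition shift2 u : 'S_k.+2 := lift0_perm (lift0_perm u : 'S_k.+1).

Lemma shift2_0 u : shift2 u o0 = o0.
Proof. by have := lift0_perm0 (lift0_perm u); rewrite (_ : 0 = o0) //; apply: val_inj. Qed.

Lemma shift2_1 u : shift2 u o1 = o1.
Proof.
have -> : o1 = lift 0 (0 : 'I_k.+1) by apply: val_inj.
by rewrite /shift2 lift0_perm_lift lift0_perm0.
Qed.

Lemma shift2_lift u (i : 'I_k) (j : 'I_k.+2) :
  j = i.+2 :> nat -> shift2 u j = (u i).+2 :> nat.
Proof.
move=> ji; have -> : j = lift 0 (lift 0 i) by apply: val_inj; rewrite /= ji.
by rewrite /shift2 !lift0_perm_lift.
Qed.

Lemma shift2M u v : (shift2 (u * v) = shift2 u * shift2 v)%g.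
Proof. by rewrite /shift2 /lift0_perm !lift_permM. Qed.

Lemma shift2_1g : shift2 1 = 1%g.
Proof. by rewrite /shift2 /lift0_perm !lift_perm1. Qed.

Lemma shift2V u : (shift2 u^-1 = (shift2 u)^-1)%g.
Proof. by rewrite /shift2 /lift0_perm !lift_permV. Qed.

Lemma shift2_inj : injective shift2.
Proof.
move=> u v uv; apply/permP => i; apply: val_inj => /=.
have ilt : (i.+2 < k.+2)%N by rewrite !ltnS.
have := @shift2_lift u i (Ordinal ilt) erefl.
by rewrite uv (@shift2_lift v i) // => -[].
Qed.

Lemma shift2_comm u : (s * shift2 u = shift2 u * s)%g.
Proof. by rewrite conjgC tpermJ shift2_0 shift2_1. Qed.

(** The image lies in the group of permutations fixing both points, and both have [k!] elements. *)
Lemma shift2_image (u : 'S_k.+2) : u o0 = o0 -> u o1 = o1 -> u \in shift2 @: setT.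
Proof.
move=> u0 u1; pose A := [set v : 'S_k.+2 | perm_on (~: [set o0; o1]) v].
have sub : shift2 @: setT \subset A.
  apply/subsetP => _ /imsetP[v _ ->]; rewrite inE; apply/subsetP => i.
  rewrite !inE; apply: contra => /orP[] /eqP->; by rewrite ?shift2_0 ?shift2_1.
suff /eqP-> : shift2 @: setT == A.
  rewrite inE; apply/subsetP => i; rewrite !inE; apply: contra => /orP[] /eqP->.
    by rewrite u0.
  by rewrite u1.
rewrite eqEcard sub card_imset ?cardsT; last exact: shift2_inj.
by rewrite cardsE card_perm cardsCs setCK cards2 card_ord subn2 /= [leqRHS]card_Sn.
Qed.

(** For [i = 0] the entry 2 takes the part of [u_0 = 0], so a peak of [u] at position 1 is shifted
    like any other. *)
Lemma word_shift2 u i : (i <= k)%N -> word (shift2 u) i.+2 = (word u i).+2.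
Proof.
case: i => [|i] ik.
  by have := word_ord (shift2 u) o1; rewrite shift2_1.
have ilt : (i.+2 < k.+2)%N by [].
have -> := word_ord (shift2 u) (Ordinal ilt).
by rewrite (@shift2_lift u (Ordinal ik)) // (word_ord u (Ordinal ik)).
Qed.

Lemma is_peak_shift2 u (i : 'I_k.+2) :
  is_peak (shift2 u) i = (1 < i)%N && is_peak u (i - 2).
Proof.
case: i => -[|[|i]] //= ilt.
  by rewrite /is_peak /= (word_ord _ o0) shift2_0 word_shift2.
rewrite subn2 /=; case: i ilt => [|i] ilt.
  by rewrite /is_peak !word_shift2 // word0 /= !ltnS ltn0 andbF.
by rewrite /is_peak /= !word_shift2 //; lia.
Qed.

Lemma is_peak_shift2s u (i : 'I_k.+2) :
  is_peak (shift2 u * s)%g i = (i == 1 :> nat) || is_peak (shift2 u) i.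
Proof.
case: i => -[|[|i]] //= ilt; last by rewrite is_peak_tperm01.
rewrite /is_peak /= !word_tperm // (word_ord _ o0) (word_ord _ o1).
by rewrite shift2_0 shift2_1.
Qed.

Lemma Peak_shift2 u v : (Peak (shift2 u) == Peak (shift2 v)) = (Peak u == Peak v).
Proof.
apply/eqP/eqP => /setP e; apply/setP => i; rewrite !inE.
  have ilt : (i.+2 < k.+2)%N by rewrite !ltnS.
  by have := e (Ordinal ilt); rewrite !inE !is_peak_shift2 /= subn2.
rewrite !is_peak_shift2; case: i => -[|[|i]] //= ilt.
by rewrite subn2; have := e (Ordinal (ilt : (i < k)%N)); rewrite !inE.
Qed.

Lemma Peak_shift2s u v : Peak u = Peak v -> Peak (shift2 u * s)%g = Peak (shift2 v * s)%g.
Proof.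
move=> /eqP; rewrite -Peak_shift2 => /eqP/setP e; apply/setP => i.
by have := e i; rewrite !inE !is_peak_shift2s => ->.
Qed.

Definition peak_quotient x : GA k :=
  [ffun w => x (shift2 w) - x (shift2 w * s)%g].

Lemma peak_quotient_alg x : in_peak_alg x -> in_peak_alg (peak_quotient x).
Proof.
move=> /peak_algP xP; apply/peak_algP => u v uv; rewrite !ffunE.
rewrite (xP _ _ (Peak_shift2s uv)); congr (_ - _); apply: xP.
by apply/eqP; rewrite Peak_shift2 uv.
Qed.

Lemma peak_quotient_linear (a : rat) x y :
  peak_quotient (a *: x + y) = a *: peak_quotient x + peak_quotient y.
Proof.
by apply/ffunP => w; rewrite !ffunE scalerBr opprD addrACA.
Qed.

Lemma peak_quotient_gone : peak_quotient (gone k.+2) = gone k.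
Proof.
apply/ffunP => w; rewrite !ffunE -[in LHS]shift2_1g (inj_eq shift2_inj) shift2_1g.
suff /negbTE-> : (shift2 w * s)%g != 1%g by rewrite subr0.
by apply/eqP => /permP/(_ o0); rewrite permM shift2_0 tpermL perm1.
Qed.

Lemma peak_quotient_surj z : in_peak_alg z ->
  exists2 x, in_peak_alg x & peak_quotient x = z.
Proof.
move=> /peak_algP zP.
(* The value is 0 on peak classes containing no [shift2 v]; the words 21w lie in such classes,
   having a peak at 1. *)
exists [ffun u => if [pick v | Peak (shift2 v) == Peak u] is Some v then z v else 0].
  by apply/peak_algP => u v uv; rewrite !ffunE uv.
apply/ffunP => w; rewrite !ffunE.
case: pickP => [v | /(_ w)]; last by rewrite eqxx.
rewrite Peak_shift2 => /eqP/zP->; case: pickP => [v' /eqP/setP/(_ o1) | ]; last by rewrite subr0.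
by rewrite !inE is_peak_shift2s is_peak_shift2.
Qed.

Lemma peak_quotient_ker x : in_peak_alg x -> (peak_quotient x = 0 <-> in_peak_ideal x).
Proof.
move=> xA; split=> [phi0 | xI].
  apply/peak_ideal_invariantP; split; first exact: peak_alg_nonadj.
  move=> u a b a0 b1.
  have -> : a = o0 by apply: val_inj.
  have -> : b = o1 by apply: val_inj.
  have eqs v : x (shift2 v * s)%g = x (shift2 v).
    by move/ffunP/(_ v): phi0; rewrite !ffunE => /eqP; rewrite subr_eq0 => /eqP->.
  (* [x] can change only at words beginning with 12 or 21, and there [eqs] applies. *)
  have [//|[[u0 u1]|[u0 u1]]] := peak_alg_tperm01 u xA (erefl : o0 = 0%N :> nat) (erefl : o1 = 1%N :> nat).
    by have /imsetP[v _ ->] := shift2_image u0 u1; apply: eqs.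
  have /imsetP[v _ us] : (u * s)%g \in shift2 @: setT.
    by apply: shift2_image; rewrite permM ?u0 ?u1 ?tpermL ?tpermR.
  by rewrite us -eqs -us -mulgA tperm2 mulg1.
apply/ffunP => w; rewrite !ffunE; apply/eqP; rewrite subr_eq0; apply/eqP.
by have /peak_ideal_invariantP[_ ->] := xI.
Qed.

(** The doubled left side is a sum over all [u] whose terms vanish unless [u] is 12v or 21v. These
    two words give equal terms, so the sum is twice the sum over [v], and the factor 2 cancels. *)
Lemma peak_quotient_gmul x y : in_peak_alg x -> in_peak_alg y ->
  peak_quotient (gmul x y) = gmul (peak_quotient x) (peak_quotient y).
Proof.
move=> xA yA; apply/ffunP => w; apply/eqP; rewrite -subr_eq0.
suff : (peak_quotient (gmul x y) w - gmul (peak_quotient x) (peak_quotient y) w) *+ 2 == 0.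
  by rewrite Num.Theory.mulrn_eq0.
rewrite mulrnBl subr_eq0 ffunE gmul_tperm_diff gmulE.
pose G (u : 'S_k.+2) := (x u - x (u * s)%g) *
  (y (shift2 w * u^-1)%g - y (shift2 w * s * u^-1)%g).
rewrite -[X in X == _]/(\sum_(u : 'S_k.+2) G u).
have Gs (u : 'S_k.+2) : G (u * s)%g = G u.
  by rewrite /G invMg tpermV !mulgA -!(mulgA _ s s) tperm2 !mulg1; ring.
have G0 (u : 'S_k.+2) : u \notin shift2 @: setT -> (u * s)%g \notin shift2 @: setT -> G u = 0.
  move=> uN usN; rewrite /G.
  have [->|[[u0 u1]|[u0 u1]]] := peak_alg_tperm01 u xA (erefl : o0 = 0%N :> nat) (erefl : o1 = 1%N :> nat).
  - by rewrite subrr mul0r.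
  - by rewrite shift2_image in uN.
  - by move/negP: usN; case; apply: shift2_image; rewrite permM ?u0 ?u1 ?tpermL ?tpermR.
have GE : \sum_(u in shift2 @: setT) G u = \sum_v peak_quotient x v * peak_quotient y (w * v^-1)%g.
  rewrite big_imset /=; last by move=> ? ? _ _; apply: shift2_inj.
  apply: eq_big => [v | v _]; rewrite ?inE // /G !ffunE shift2M shift2V.
  (* Commuting [s] past [shift2] turns the second factor into a value of [peak_quotient y]. *)
  by rewrite -!mulgA -shift2V shift2_comm.
rewrite (bigID (mem (shift2 @: setT))) /= GE mulr2n (inj_eq (addrI _)) -GE.
rewrite (bigID (fun u : 'S_k.+2 => (u * s)%g \in shift2 @: setT)) /= addrC big1 ?add0r; last first.
  by move=> u /andP[]; apply: G0.
rewrite [X in _ == X](reindex_inj (mulIg s)) /=; apply/eqP/eq_big => [u | u _]; last by rewrite Gs.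
apply: andb_idl => /imsetP[v _ us]; apply/negP => /imsetP[v' _ u'].
by move/permP/(_ o0): us; rewrite u' permM !shift2_0 tpermL.
Qed.

End Quotient.

Theorem theorem5p7 (n : nat) :
  (* the peak ideal is a two-sided ideal of the peak algebra *)
  ((forall x : GA n, in_peak_ideal x -> in_peak_alg x) /\
   (forall x y : GA n, in_peak_alg x -> in_peak_ideal y ->
      in_peak_ideal (gmul x y) /\ in_peak_ideal (gmul y x))) /\
  (* quotient isomorphism, via the first isomorphism theorem *)
  ((2 <= n)%N ->
   exists phi : GA n -> GA (n - 2),
     (forall x, in_peak_alg x -> in_peak_alg (phi x)) /\
     [/\          forall (a : rat) x y, in_peak_alg x -> in_peak_alg y ->
           phi (a *: x + y) = a *: phi x + phi y,
         forall x y, in_peak_alg x -> in_peak_alg y ->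
           phi (gmul x y) = gmul (phi x) (phi y),
         phi (gone n) = gone (n - 2),
         forall z, in_peak_alg z -> exists2 x, in_peak_alg x & phi x = z
       & forall x, in_peak_alg x -> (phi x = 0 <-> in_peak_ideal x)]).
Proof.
split; first by split; [exact: peak_ideal_sub_alg | exact: peak_ideal_gmul].
move=> n2; set k := (n - 2)%N; have En : n = k.+2 by rewrite /k; lia.
clearbody k; subst n; exists (@peak_quotient k); split; first exact: peak_quotient_alg.
split.
- by move=> a x y _ _; apply: peak_quotient_linear.
- exact: peak_quotient_gmul.
- exact: peak_quotient_gone.
- exact: peak_quotient_surj.
- exact: peak_quotient_ker.
Qed.
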